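(* Let $\mathcal{B}: H^1 \to H^1$ be the operator $\mathcal{B}(f) = f - f(0)$. Then the operator norm of $\mathcal{B}$ on the Hardy space $H^1$ is at most $1.952396$.
   Context: $\mathbb{D}$ is the open unit disc in $\mathbb{C}$. $H^1$ is the space of analytic functions $f$ on $\mathbb{D}$ with $\|f\|_{H^1} = \sup_{0\le r<1} \frac{1}{2\pi}\int_0^{2\pi} |f(re^{i\theta})|\,d\theta < \infty$. *)

(* Defs.v *)
From Stdlib Require Import Reals.
From Coquelicot Require Import Coquelicot.
Open Scope R_scope.

(* A function on a subset of C is represented by a total function C -> C whose
   values outside the subset are never used. *)

Definition unit_disc (z : C) : Prop := Cmod z < 1.

(* Meant for open [U]: at each point of [U], [f] is locally the sum of a
   convergent power series. *)
Definition analytic_on (U : C -> Prop) (f : C -> C) : Prop :=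
  forall z0 : C, U z0 ->
    exists a : nat -> C,
      locally (T := C_UniformSpace) z0
        (fun z : C =>
           is_pseries (K := C_AbsRing) (V := C_NormedModule)
             a (z - z0)%C (f z)).

Definition circle_pt (r theta : R) : C := (r * cos theta, r * sin theta).

(* The integrand is continuous when [f] is analytic on the unit disc and
   0 <= r < 1, so the Riemann integral is then a genuine one. *)
Definition circle_mean (f : C -> C) (r : R) : R :=
  / (2 * PI) * RInt (fun theta => Cmod (f (circle_pt r theta))) 0 (2 * PI).

Definition H1_norm (f : C -> C) : Rbar :=
  Lub_Rbar (fun m => exists r : R, 0 <= r < 1 /\ m = circle_mean f r).

Definition in_H1 (f : C -> C) : Prop :=
  analytic_on unit_disc f /\ Rbar_lt (H1_norm f) p_infty.

(* Supremum of |T f| over the closed unit ball of H^1, taken in the extended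
   reals, so that an unbounded operator has norm +oo. *)
Definition H1_operator_norm (T : (C -> C) -> (C -> C)) : Rbar :=
  Rbar_lub (fun N => exists f : C -> C,
    in_H1 f /\ Rbar_le (H1_norm f) (Finite 1) /\ N = H1_norm (T f)).

Definition opB (f : C -> C) : C -> C := fun z => (f z - f (RtoC 0))%C.

(* Main.v *)
Require Import Defs.
From Stdlib Require Import Reals Lra Lia Classical IndefiniteDescription.
From Coquelicot Require Import Coquelicot.
Open Scope R_scope.

(* Normalise f(0) = 1.  For w <> 0,
     |w - 1| <= 1.95 |w| + 0.9 (1 - Re w) - 0.05 ln |w|,
   and the right-hand side is superharmonic in w apart from the term in |w|.
   Averaging w = f(r e^(it)) over a circle, the term in Re w vanishes by the mean
   value property and the logarithm is controlled by Jensen's inequality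
   0 = ln |f(0)| <= mean of ln |f|, which leaves
   mean |f - 1| <= 1.95 mean |f|. *)

(** The logarithm is what brings the constant below 2. In a pointwise bound |w - 1| <= C |w| + k (1
    - Re w), the point w = 0 forces k >= 1, and large positive w force C >= 1 + k, so C >= 2, which
    is only the triangle inequality. The term -0.05 ln |w| is +oo at w = 0 and of lower order at
    infinity. It permits k = 0.9, after which the behaviour at infinity only asks for C > 1.9; the
    choice 1.95 leaves room for elementary bounds on the logarithm. The complex analysis reduces to
    one fact, the mean value property of Re F on circles about 0. It is applied twice: to the
    normalised function itself, and to a product of its rotations, which gives the form of Jensen's
    inequality that is needed. *)

(** * The pointwise inequality in the plane *)

Lemma ln_le_pred (x : R) : 0 < x -> ln x <= x - 1.
Proof.
  intros Hx.
  pose proof (exp_ineq1_le (ln x)) as H.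
  rewrite exp_ln in H; lra.
Qed.

(** This is ln (27 x) <= 27 x - 1 combined with ln 27 >= 3. It serves for |w| <= 1/10, where ln x <=
    x - 1 is too weak: the singularity at 0 has to make up for the coefficient 9/10 being less than
    1. *)
Lemma ln_le_near_0 (x : R) : 0 < x -> ln x <= 27 * x - 4.
Proof.
  intros Hx.
  assert (H3 : 1 <= ln 3).
  { rewrite <- (ln_exp 1). apply ln_le; [apply exp_pos | apply exp_le_3]. }
  pose proof (ln_le_pred (3 * (3 * (3 * x))) ltac:(lra)) as H.
  rewrite !ln_mult in H; lra.
Qed.

Lemma Cmod_sub_one_le_log (w : C) : 0 < Cmod w ->
  Cmod (w - 1)%C + / 20 * ln (Cmod w)
    <= 195 / 100 * Cmod w + 9 / 10 * (1 - Re w).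
Proof.
  intros Hw.
  pose proof (Cmod_ge_0 (w - 1)%C) as HD.
  pose proof (Cmod2_alt w) as Ew.
  pose proof (Cmod2_alt (w - 1)%C) as ED.
  replace (Re (w - 1)%C) with (Re w - 1) in ED by (destruct w; simpl; ring).
  replace (Im (w - 1)%C) with (Im w) in ED by (destruct w; simpl; ring).
  pose proof (re_le_Cmod w) as Hx.
  pose proof (Rle_abs (Re w)) as Hx'.
  pose proof (ln_le_pred _ Hw) as L1.
  pose proof (ln_le_near_0 _ Hw) as L2.
  set (D := Cmod (w - 1)%C) in *. set (p := Cmod w) in *.
  set (x := Re w) in *. set (y := Im w) in *.
  assert (E : D ^ 2 = p ^ 2 - 2 * x + 1) by nra.
  destruct (Rle_lt_dec p 3) as [H3 | H3].
  - (* AM-GM with the weights that make the dependence on [x] cancel *)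
    assert (D <= 45 / 100 * D ^ 2 + 5 / 9) by (pose proof (pow2_ge_0 (9 * D - 10)); nra).
    destruct (Rle_lt_dec p (1 / 10)).
    + nra.
    + nra.
  (* Since D^2 = (p - 1)^2 + 2 (p - x), squaring the right-hand side gives at least D^2 as soon as p
     - 1 >= 2; hence the threshold 3. *)
  - assert (D <= (p - 1) + (p - x) / 2).
    { apply Rnot_lt_le. intros Hlt.
      assert (((p - 1) + (p - x) / 2) ^ 2 < D ^ 2) by nra.
      nra. }
    nra.
Qed.

(** * Strict complex differentiability *)

(** Both points of the difference quotient move. A derivative in this sense is automatically
    continuous, so differentiation under the integral sign becomes available without differentiating
    power series, and products are handled without multiplying them. *)
Definition strict_deriv (f : C -> C) (z d : C) : Prop :=
  forall eps : R, 0 < eps -> exists delta : R, 0 < delta /\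
    forall u v : C, Cmod (u - z)%C < delta -> Cmod (v - z)%C < delta ->
      Cmod (f u - f v - d * (u - v))%C <= eps * Cmod (u - v)%C.

Lemma strict_deriv_cont (f : C -> C) (z d : C) (eps : R) :
  strict_deriv f z d -> 0 < eps -> exists delta : R, 0 < delta /\
    forall u : C, Cmod (u - z)%C < delta -> Cmod (f u - f z)%C < eps.
Proof.
  intros H He.
  destruct (H 1 Rlt_0_1) as [r [Hr Hf]].
  pose proof (Cmod_ge_0 d) as Hd.
  exists (Rmin r (eps / (2 + Cmod d))). split.
  - apply Rmin_pos; [lra | apply Rdiv_lt_0_compat; lra].
  - intros u Hu.
    assert (Hu1 := Rlt_le_trans _ _ _ Hu (Rmin_l _ _)).
    assert (Hu2 := Rlt_le_trans _ _ _ Hu (Rmin_r _ _)).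
    assert (Hz : Cmod (z - z)%C < r) by (replace (z - z)%C with (RtoC 0) by ring; rewrite Cmod_0; lra).
    pose proof (Hf u z Hu1 Hz) as K.
    replace (f u - f z)%C with ((f u - f z - d * (u - z)) + d * (u - z))%C by ring.
    eapply Rle_lt_trans; [apply Cmod_triangle |].
    rewrite Cmod_mult.
    apply (Rmult_lt_compat_l (2 + Cmod d)) in Hu2; [| lra].
    replace ((2 + Cmod d) * (eps / (2 + Cmod d))) with eps in Hu2 by (field; lra).
    pose proof (Cmod_ge_0 (u - z)%C). nra.
Qed.

Lemma strict_deriv_mult (f g : C -> C) (z d e : C) :
  strict_deriv f z d -> strict_deriv g z e ->
  strict_deriv (fun w => f w * g w)%C z (d * g z + f z * e)%C.
Proof.
  intros Hf Hg eps He.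
  pose proof (Cmod_ge_0 d) as Hd. pose proof (Cmod_ge_0 e) as He'.
  pose proof (Cmod_ge_0 (f z)) as Hfz. pose proof (Cmod_ge_0 (g z)) as Hgz.
  set (M := 2 + Cmod d + Cmod e + Cmod (f z) + Cmod (g z)).
  set (k := Rmin 1 (eps / (4 * M))).
  assert (HM : 0 < M) by (unfold M; lra).
  assert (Hk : 0 < k) by (apply Rmin_pos; [lra | apply Rdiv_lt_0_compat; lra]).
  assert (Hk1 : k <= 1) by apply Rmin_l.
  assert (HkM : 4 * M * k <= eps).
  { apply Rle_trans with (4 * M * (eps / (4 * M))).
    - apply Rmult_le_compat_l; [lra | apply Rmin_r].
    - right; field; lra. }
  destruct (Hf k Hk) as [r1 [Hr1 F1]].
  destruct (Hg k Hk) as [r2 [Hr2 G1]].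
  destruct (strict_deriv_cont _ _ _ k Hf Hk) as [r3 [Hr3 F2]].
  destruct (strict_deriv_cont _ _ _ k Hg Hk) as [r4 [Hr4 G2]].
  exists (Rmin (Rmin r1 r2) (Rmin r3 r4)).
  split; [repeat apply Rmin_pos; assumption |].
  assert (Hmin : forall t, t < Rmin (Rmin r1 r2) (Rmin r3 r4) ->
            t < r1 /\ t < r2 /\ t < r3 /\ t < r4).
  { intros t Ht.
    pose proof (Rmin_l (Rmin r1 r2) (Rmin r3 r4)).
    pose proof (Rmin_r (Rmin r1 r2) (Rmin r3 r4)).
    pose proof (Rmin_l r1 r2). pose proof (Rmin_r r1 r2).
    pose proof (Rmin_l r3 r4). pose proof (Rmin_r r3 r4). lra. }
  intros u v Hu Hv.
  apply Hmin in Hu. apply Hmin in Hv.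
  destruct Hu as [U1 [U2 [U3 U4]]]. destruct Hv as [V1 [V2 [V3 V4]]].
  specialize (F1 u v U1 V1). specialize (G1 u v U2 V2).
  pose proof (F2 v V3) as Fv. pose proof (G2 u U4) as Gu.
  (* Each of the four summands has one factor controlled by [k], one bounded by [M], and one power
     of |u - v|, hence the total 4 M k |u - v|. *)
  replace (f u * g u - f v * g v - (d * g z + f z * e) * (u - v))%C with
    ((f u - f v - d * (u - v)) * (g z + (g u - g z)) + d * (u - v) * (g u - g z)
     + ((f z + (f v - f z)) * (g u - g v - e * (u - v)) + (f v - f z) * (e * (u - v))))%C by ring.
  set (h := (u - v)%C) in *.
  pose proof (Cmod_ge_0 h) as Hh.
  assert (Gu' : Cmod (g z + (g u - g z))%C <= M).
  { eapply Rle_trans; [apply Cmod_triangle |]. unfold M; lra. }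
  assert (Fv' : Cmod (f z + (f v - f z))%C <= M).
  { eapply Rle_trans; [apply Cmod_triangle |]. unfold M; lra. }
  assert (Hd' : Cmod d <= M) by (unfold M; lra).
  assert (He'' : Cmod e <= M) by (unfold M; lra).
  apply Rle_trans with (4 * M * k * Cmod h);
    [| apply Rmult_le_compat_r; assumption].
  assert (T : forall a b x y : R, 0 <= a -> 0 <= b -> a <= x -> b <= y -> a * b <= x * y)
    by (intros; apply Rmult_le_compat; assumption).
  assert (T1 := T _ _ _ _ (Cmod_ge_0 _) (Cmod_ge_0 _) F1 Gu').
  assert (T2 := T _ _ _ _ (Cmod_ge_0 _) (Cmod_ge_0 _) Hd' (Rlt_le _ _ Gu)).
  assert (T3 := T _ _ _ _ (Cmod_ge_0 _) (Cmod_ge_0 _) Fv' G1).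
  assert (T4 := T _ _ _ _ (Cmod_ge_0 _) (Cmod_ge_0 _) (Rlt_le _ _ Fv) He'').
  apply (Rmult_le_compat_r (Cmod h)) in T2; [| assumption].
  apply (Rmult_le_compat_r (Cmod h)) in T4; [| assumption].
  eapply Rle_trans; [apply Cmod_triangle |].
  eapply Rle_trans; [apply Rplus_le_compat; apply Cmod_triangle |].
  rewrite !Cmod_mult. lra.
Qed.

Lemma strict_deriv_const (c z : C) : strict_deriv (fun _ => c) z 0%C.
Proof.
  intros eps He. exists 1. split; [lra |]. intros u v _ _.
  replace (c - c - 0 * (u - v))%C with (RtoC 0) by ring.
  rewrite Cmod_0. pose proof (Cmod_ge_0 (u - v)%C). nra.
Qed.

Lemma strict_deriv_rot (f : C -> C) (l z d : C) : Cmod l = 1 ->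
  strict_deriv f (l * z)%C d -> strict_deriv (fun w => f (l * w)%C) z (d * l)%C.
Proof.
  intros Hl H eps He. destruct (H eps He) as [r [Hr Hf]].
  exists r. split; [assumption |]. intros u v Hu Hv.
  assert (E : forall a b : C, Cmod (l * a - l * b)%C = Cmod (a - b)%C).
  { intros a b. replace (l * a - l * b)%C with (l * (a - b))%C by ring.
    rewrite Cmod_mult, Hl. ring. }
  specialize (Hf (l * u)%C (l * v)%C).
  rewrite !E in Hf. specialize (Hf Hu Hv).
  replace (d * l * (u - v))%C with (d * (l * u - l * v))%C by ring.
  assumption.
Qed.

(** The same increment f(w + t) - f(w) is close to d(z) t by strictness at z, and close to d(w) t by
    differentiability at w. Subtracting and dividing by t compares the two derivatives; t may depend
    on w, while the radius around z does not. *)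
Lemma strict_deriv_deriv_cont (f : C -> C) (d : C -> C) (z : C) (eps : R) :
  (exists r, 0 < r /\ forall w, Cmod (w - z)%C < r -> strict_deriv f w (d w)) ->
  0 < eps -> exists delta : R, 0 < delta /\
    forall w : C, Cmod (w - z)%C < delta -> Cmod (d w - d z)%C <= eps.
Proof.
  intros [r [Hr H]] He.
  assert (Hz : strict_deriv f z (d z)).
  { apply H. replace (z - z)%C with (RtoC 0) by ring. rewrite Cmod_0; assumption. }
  destruct (Hz (eps / 2) ltac:(lra)) as [r1 [Hr1 F]].
  exists (Rmin r (r1 / 2)). split; [apply Rmin_pos; lra |].
  intros w Hw.
  assert (Hw1 := Rlt_le_trans _ _ _ Hw (Rmin_l _ _)).
  assert (Hw2 := Rlt_le_trans _ _ _ Hw (Rmin_r _ _)).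
  destruct (H w Hw1 (eps / 2) ltac:(lra)) as [r2 [Hr2 G]].
  set (t := Rmin r1 r2 / 4).
  assert (Ht : 0 < t) by (apply Rdiv_lt_0_compat; [apply Rmin_pos; lra | lra]).
  assert (Ht1 : 4 * t <= r1) by (unfold t; pose proof (Rmin_l r1 r2); lra).
  assert (Ht2 : 4 * t <= r2) by (unfold t; pose proof (Rmin_r r1 r2); lra).
  assert (Et : Cmod (RtoC t) = t) by (rewrite Cmod_R, Rabs_pos_eq; lra).
  assert (Fw := F (w + t)%C w).
  assert (Gw := G (w + t)%C w).
  replace (w + t - w)%C with (RtoC t) in Fw, Gw by ring.
  replace (w - w)%C with (RtoC 0) in Gw by ring.
  rewrite Cmod_0, Et in *.
  assert (Cmod (w + t - z)%C < r1).
  { replace (w + t - z)%C with ((w - z) + t)%C by ring.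
    eapply Rle_lt_trans; [apply Cmod_triangle |]. lra. }
  specialize (Fw ltac:(assumption) ltac:(lra)).
  specialize (Gw ltac:(lra) ltac:(lra)).
  apply Rmult_le_reg_r with t; [assumption |].
  replace (Cmod (d w - d z)%C * t) with (Cmod ((d w - d z) * t)%C)
    by (rewrite Cmod_mult, Et; ring).
  replace ((d w - d z) * t)%C with
    ((f (w + t) - f w - d z * t) + - (f (w + t) - f w - d w * t))%C by ring.
  eapply Rle_trans; [apply Cmod_triangle |]. rewrite Cmod_opp. lra.
Qed.

(** * From power series to strict derivatives *)

Lemma Cmod_pow_sub_le (p q : C) (rho : R) (n : nat) :
  Cmod p <= rho -> Cmod q <= rho ->
  Cmod (p ^ (S n) - q ^ (S n))%C <= INR (S n) * rho ^ n * Cmod (p - q)%C.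
Proof.
  intros Hp Hq.
  pose proof (Cmod_ge_0 p) as Hp0. pose proof (Cmod_ge_0 (p - q)%C) as Hpq.
  induction n as [| n IH].
  - replace (p ^ 1 - q ^ 1)%C with (p - q)%C by (simpl; ring). simpl. lra.
  - replace (p ^ S (S n) - q ^ S (S n))%C with
      (p ^ S n * (p - q) + (p ^ S n - q ^ S n) * q)%C by (simpl; ring).
    eapply Rle_trans; [apply Cmod_triangle |].
    rewrite !Cmod_mult, Cmod_pow.
    assert (H1 : Cmod p ^ S n <= rho ^ S n) by (apply pow_incr; lra).
    assert (H2 : Cmod (p ^ S n - q ^ S n)%C * Cmod q
                 <= INR (S n) * rho ^ n * Cmod (p - q)%C * rho)
      by (apply Rmult_le_compat; auto using Cmod_ge_0).
    apply (Rmult_le_compat_r (Cmod (p - q)%C)) in H1; [| assumption].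
    rewrite (S_INR (S n)). simpl (rho ^ S n) in *. lra.
Qed.

Lemma is_pseries_C_bounded (a : nat -> C) (z l : C) :
  is_pseries (K := C_AbsRing) (V := C_NormedModule) a z l ->
  exists A : R, 0 < A /\ forall n, Cmod (a n) * Cmod z ^ n <= A.
Proof.
  intros H.
  destruct (filterlim_bounded
    (sum_n (fun k => scal (V := C_NormedModule) (pow_n (K := C_AbsRing) z k) (a k))))
    as [M HM]; [exists l; exact H |].
  exists (2 * M + 1).
  assert (M0 : 0 <= M) by exact (Rle_trans _ _ _ (norm_ge_0 _) (HM 0%nat)).
  split; [lra |].
  assert (E : forall n, Cmod (a n) * Cmod z ^ n =
     norm (scal (V := C_NormedModule) (pow_n (K := C_AbsRing) z n) (a n))).
  { intros n. rewrite <- Cmod_pow, Rmult_comm, <- Cmod_mult.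
    change (Cmod (z ^ n * a n)%C = Cmod (pow_n (K := C_AbsRing) z n * a n)%C).
    reflexivity. }
  intros n. rewrite E. destruct n as [| n].
  - specialize (HM 0%nat). rewrite sum_O in HM. lra.
  - pose proof (HM n) as H1. pose proof (HM (S n)) as H2.
    rewrite sum_Sn in H2.
    set (s := sum_n _ n) in *. set (t := scal _ _) in *.
    change (Cmod s <= M) in H1. change (Cmod (s + t)%C <= M) in H2.
    change (Cmod t <= 2 * M + 1).
    replace (t : C) with ((s + t) + - s)%C by ring.
    eapply Rle_trans; [apply Cmod_triangle |]. rewrite Cmod_opp. lra.
Qed.

(** The terms of index 0 and 1 account for the subtracted linear part. For n >= 2, the bounds |a_n|
    <= A / R0^n, |p^n - q^n| <= n rho^(n-1) |p - q|, n <= 2^n and rho <= R0 / 4 make the n-th term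
    at most B / 2^n with B = 16 A rho |p - q| / R0^2, and the geometric series sums to 2 B. The
    surviving factor rho makes the Lipschitz constant of the remainder arbitrarily small. *)
Lemma sub_linear_part_le (a : nat -> C) (A R0 rho : R) (p q lp lq : C) :
  0 < R0 -> 0 < rho -> rho <= R0 / 4 ->
  (forall n, Cmod (a n) * R0 ^ n <= A) ->
  Cmod p <= rho -> Cmod q <= rho ->
  is_pseries (K := C_AbsRing) (V := C_NormedModule) a p lp ->
  is_pseries (K := C_AbsRing) (V := C_NormedModule) a q lq ->
  Cmod (lp - lq - a 1%nat * (p - q))%C <= 32 * A * rho / R0 ^ 2 * Cmod (p - q)%C.
Proof.
  intros HR Hr Hr4 HA Hp Hq Sp Sq.
  pose proof (is_series_minus _ _ _ _ Sp Sq) as S1.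
  set (T := fun n => match n with O => RtoC 0 | 1%nat => RtoC 0
     | _ => (a n * (p ^ n - q ^ n))%C end).
  set (h := Cmod (p - q)%C).
  assert (Hh : 0 <= h) by apply Cmod_ge_0.
  assert (A0 : 0 <= A).
  { specialize (HA 0%nat). simpl in HA. pose proof (Cmod_ge_0 (a 0%nat)). lra. }
  set (B := 16 * A * rho / R0 ^ 2 * h).
  assert (PR : 0 < R0 ^ 2) by (apply pow_lt; lra).
  assert (B0 : 0 <= B).
  { unfold B. apply Rmult_le_pos; [| assumption].
    apply Rmult_le_pos; [nra | left; apply Rinv_0_lt_compat; assumption]. }
  assert (HT : forall n, Cmod (T n) <= B * (/ 2) ^ n).
  { assert (P : forall n, 0 <= B * (/ 2) ^ n) by (intros; apply Rmult_le_pos; [lra | apply pow_le; lra]).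
    intros [| [| n]]; unfold T; [rewrite Cmod_0; apply P .. |].
    rewrite Cmod_mult.
    apply Rle_trans with (Cmod (a (S (S n))) * (INR (S (S n)) * rho ^ S n * h)).
    { apply Rmult_le_compat_l; [apply Cmod_ge_0 |]. apply Cmod_pow_sub_le; assumption. }
    assert (N2 : INR (S (S n)) <= 2 ^ S (S n)).
    { clear. set (m := S (S n)). induction m as [| m IH]; [simpl; lra |].
      rewrite S_INR. assert (1 <= 2 ^ m) by (apply pow_R1_Rle; lra). simpl; lra. }
    assert (H4 : rho ^ n <= (R0 / 4) ^ n) by (apply pow_incr; lra).
    assert (Q : Cmod (a (S (S n))) <= A / R0 ^ S (S n)).
    { apply Rmult_le_reg_r with (R0 ^ S (S n)); [apply pow_lt; lra |].
      replace (A / R0 ^ S (S n) * R0 ^ S (S n)) with A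
        by (field; apply Rgt_not_eq, (pow_lt R0 (S (S n))); lra).
      apply HA. }
    apply Rle_trans with (A / R0 ^ S (S n) * (2 ^ S (S n) * (rho * (R0 / 4) ^ n) * h)).
    - apply Rmult_le_compat; [apply Cmod_ge_0 | | assumption |].
      + repeat apply Rmult_le_pos; try apply pow_le; auto using pos_INR; lra.
      + apply Rmult_le_compat_r; [assumption |].
        apply Rmult_le_compat; [apply pos_INR | apply pow_le; lra | assumption |].
        simpl. apply Rmult_le_compat_l; lra.
    - right. unfold B, Rdiv. rewrite !Rpow_mult_distr.
      replace (/ 4) with (/ 2 * / 2) by lra. rewrite Rpow_mult_distr.
      assert (R0 ^ n <> 0) by (apply pow_nonzero; lra).
      assert (2 ^ n <> 0) by (apply pow_nonzero; lra).
      rewrite !pow_inv. simpl. field. lra. }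
  assert (ST : is_series (K := C_AbsRing) (V := C_NormedModule) T (lp - lq - a 1%nat * (p - q))%C).
  { apply is_series_decr_1, is_series_decr_1.
    eapply is_series_ext; [| apply is_series_incr_1, is_series_incr_1].
    2: { match type of S1 with is_series ?u ?l => 
           replace l with (plus (plus (plus (plus (lp - lq - a 1%nat * (p - q))%C (opp (T 0%nat))) (opp (T 1%nat)))
               (u 1%nat)) (u 0%nat)) in S1 end; [exact S1 |].
         unfold T. simpl.
         unfold plus, opp, scal, mult, one; simpl. unfold mult, one; simpl. ring. }
    intros n.
    change ((p ^ S (S n) * a (S (S n)) + - (q ^ S (S n) * a (S (S n))))%C
            = (a (S (S n)) * (p ^ S (S n) - q ^ S (S n)))%C).
    ring. }
  assert (HS : forall n, Cmod (sum_n (G := C_NormedModule) T n) <= B * (2 - (/ 2) ^ n)).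
  { induction n as [| n IH].
    - rewrite sum_O. specialize (HT 0%nat). simpl in *. lra.
    - rewrite sum_Sn. specialize (HT (S n)).
      eapply Rle_trans; [apply Cmod_triangle |]. simpl pow in *. lra. }
  assert (L : is_lim_seq (fun n => norm (sum_n (G := C_NormedModule) T n))
                 (Cmod (lp - lq - a 1%nat * (p - q))%C)).
  { exact (filterlim_comp _ _ _ _ _ _ _ _ ST (filterlim_norm _)). }
  replace (32 * A * rho / R0 ^ 2 * h) with (2 * B) by (unfold B; field; lra).
  refine (is_lim_seq_le _ (fun _ => 2 * B) _ (2 * B) _ L (is_lim_seq_const _)).
  intros n. eapply Rle_trans; [exact (HS n) |].
  assert (0 <= (/ 2) ^ n) by (apply pow_le; lra). nra.
Qed.

Lemma analytic_strict_deriv (f : C -> C) (z0 : C) :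
  analytic_on unit_disc f -> Cmod z0 < 1 -> exists d : C, strict_deriv f z0 d.
Proof.
  intros Hf Hz. destruct (Hf z0 Hz) as [a [dl Ha]].
  assert (S1 : forall z, Cmod (z - z0)%C < dl ->
     is_pseries (K := C_AbsRing) (V := C_NormedModule) a (z - z0)%C (f z)).
  { intros z Hd. apply Ha. apply C_NormedModule_mixin_compat1. exact Hd. }
  pose proof (cond_pos dl) as Hdl.
  set (R0 := dl / 2).
  assert (HR : 0 < R0) by (unfold R0; lra).
  assert (ER : Cmod (RtoC R0) = R0) by (rewrite Cmod_R, Rabs_pos_eq; lra).
  assert (SR := S1 (z0 + R0)%C).
  replace (z0 + R0 - z0)%C with (RtoC R0) in SR by ring.
  destruct (is_pseries_C_bounded _ _ _ (SR ltac:(rewrite ER; unfold R0; lra))) as [A [A0 HA]].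
  rewrite ER in HA.
  exists (a 1%nat). intros eps He.
  assert (PR : 0 < R0 ^ 2) by (apply pow_lt; lra).
  (* The second entry brings the Lipschitz constant 32 A rho / R0^2 of the remainder down to
     [eps]. *)
  set (rho := Rmin (R0 / 4) (eps * R0 ^ 2 / (32 * A))).
  assert (Hr : 0 < rho).
  { apply Rmin_pos; [lra |]. apply Rdiv_lt_0_compat; [apply Rmult_lt_0_compat |]; lra. }
  assert (Hr1 : rho <= R0 / 4) by apply Rmin_l.
  assert (Hr2 : rho <= eps * R0 ^ 2 / (32 * A)) by apply Rmin_r.
  exists rho. split; [assumption |]. intros u v Hu Hv.
  assert (K := sub_linear_part_le a A R0 rho (u - z0) (v - z0) (f u) (f v) HR Hr Hr1 HA
     (Rlt_le _ _ Hu) (Rlt_le _ _ Hv)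
     (S1 u ltac:(unfold R0 in *; lra)) (S1 v ltac:(unfold R0 in *; lra))).
  replace (u - z0 - (v - z0))%C with (u - v)%C in K by ring.
  eapply Rle_trans; [exact K |]. apply Rmult_le_compat_r; [apply Cmod_ge_0 |].
  apply Rle_trans with (32 * A * (eps * R0 ^ 2 / (32 * A)) / R0 ^ 2).
  - apply Rmult_le_compat_r; [left; apply Rinv_0_lt_compat; lra |].
    apply Rmult_le_compat_l; lra.
  - right; field; lra.
Qed.

Lemma analytic_on_sub_const (U : C -> Prop) (f : C -> C) (c : C) :
  analytic_on U f -> analytic_on U (fun z => f z - c)%C.
Proof.
  intros Hf z0 Hz. destruct (Hf z0 Hz) as [a Ha].
  set (b := fun n : nat => match n with O => c | _ => RtoC 0 end).
  exists (PS_minus (V := C_NormedModule) a b).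
  apply (filter_imp (fun z => is_pseries (K := C_AbsRing) (V := C_NormedModule) a (z - z0)%C (f z)));
    [| exact Ha].
  intros z Hz'. refine (is_pseries_minus _ _ _ _ _ Hz' _).
  unfold is_pseries, is_series.
  apply filterlim_ext with (fun _ => c); [| apply filterlim_const].
  intros n. induction n as [| n IH].
  - rewrite sum_O. unfold scal; simpl. unfold mult, one; simpl. ring.
  - rewrite sum_Sn, <- IH. unfold plus, scal; simpl. unfold mult; simpl. ring.
Qed.

(** * Continuity on circles and the mean value property *)

Definition strictly_differentiable (f : C -> C) : Prop :=
  forall z : C, Cmod z < 1 -> exists d : C, strict_deriv f z d.

Lemma Cmod_le_2max (x y e : R) : Rabs x <= e -> Rabs y <= e -> Cmod (x, y) <= 2 * e.
Proof.
  intros Hx Hy.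
  replace (x, y) with (RtoC x + RtoC y * Ci)%C
    by (apply injective_projections; simpl; ring).
  eapply Rle_trans; [apply Cmod_triangle |].
  rewrite Cmod_mult, Cmod_Ci, !Cmod_R. lra.
Qed.

Lemma Rabs_fst_le_Cmod (z : C) : Rabs (fst z) <= Cmod z.
Proof. eapply Rle_trans; [apply Rmax_l | apply Rmax_Cmod]. Qed.

Lemma Rabs_snd_le_Cmod (z : C) : Rabs (snd z) <= Cmod z.
Proof. eapply Rle_trans; [apply Rmax_r | apply Rmax_Cmod]. Qed.

(** The Cauchy-Riemann equations: multiplication by p + iq acts on the real plane by the matrix with
    rows (p, -q) and (q, p). *)
Lemma strict_deriv_differentiable (f : C -> C) (x y p q : R) :
  strict_deriv f (x, y) (p, q) ->
  differentiable_pt_lim (fun u v => fst (f (u, v))) x y p (- q) /\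
  differentiable_pt_lim (fun u v => snd (f (u, v))) x y q p.
Proof.
  intros H.
  assert (K : forall eps : posreal, locally_2d (fun u v =>
    Cmod (f (u, v) - f (x, y) - (p, q) * ((u, v) - (x, y)))%C
      <= eps * Rmax (Rabs (u - x)) (Rabs (v - y))) x y).
  { intros eps. pose proof (cond_pos eps) as He.
    destruct (H (eps / 2) ltac:(lra)) as [r [Hr F]].
    exists (mkposreal (r / 2) ltac:(lra)). simpl. intros u v Hu Hv.
    set (m := Rmax (Rabs (u - x)) (Rabs (v - y))).
    assert (Hm : Cmod ((u, v) - (x, y))%C <= 2 * m)
      by (apply Cmod_le_2max; [apply Rmax_l | apply Rmax_r]).
    assert (Hmr : 2 * m < r) by (unfold m; apply Rmax_case; lra).
    assert (F0 : Cmod ((x, y) - (x, y))%C < r).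
    { replace ((x, y) - (x, y))%C with (RtoC 0) by ring. rewrite Cmod_0; lra. }
    specialize (F (u, v) (x, y) ltac:(lra) F0).
    eapply Rle_trans; [exact F |]. nra. }
  split; intros eps; destruct (K eps) as [r Hr]; exists r; intros u v Hu Hv;
    specialize (Hr u v Hu Hv); eapply Rle_trans; try exact Hr.
  - eapply Rle_trans; [| apply Rabs_fst_le_Cmod].
    right; f_equal. simpl. ring.
  - eapply Rle_trans; [| apply Rabs_snd_le_Cmod].
    right; f_equal. simpl. ring.
Qed.

Lemma continuity_2d_circle (g : C -> R) (r t : R) :
  (forall eps : R, 0 < eps -> exists delta : R, 0 < delta /\
     forall w, Cmod (w - circle_pt r t)%C < delta -> Rabs (g w - g (circle_pt r t)) < eps) ->
  continuity_2d_pt (fun u v => g (circle_pt u v)) r t.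
Proof.
  intros H eps. destruct (H eps (cond_pos eps)) as [dl [Hd G]].
  set (e := mkposreal (dl / 3) ltac:(lra)).
  assert (C1 : continuity_2d_pt (fun u v => u * cos v) r t).
  { apply continuity_2d_pt_mult; [apply continuity_2d_pt_id1 |].
    apply continuity_1d_2d_pt_comp; [apply continuity_cos | apply continuity_2d_pt_id2]. }
  assert (C2 : continuity_2d_pt (fun u v => u * sin v) r t).
  { apply continuity_2d_pt_mult; [apply continuity_2d_pt_id1 |].
    apply continuity_1d_2d_pt_comp; [apply continuity_sin | apply continuity_2d_pt_id2]. }
  generalize (locally_2d_and _ _ _ _ (C1 e) (C2 e)).
  apply locally_2d_impl, locally_2d_forall. intros u v [H1 H2].
  apply G. simpl in H1, H2.
  eapply Rle_lt_trans; [apply Cmod_le_2max with (e := dl / 3) |]; simpl; try lra;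
    left; assumption.
Qed.

Lemma continuity_2d_pt_snd (h : R -> R -> R) (r t : R) :
  continuity_2d_pt h r t -> continuous (h r) t.
Proof.
  intros H.
  apply filterlim_locally. intros eps. destruct (H eps) as [dl Hd].
  exists dl. intros y Hy. apply Hd; [rewrite Rminus_diag, Rabs_R0; apply cond_pos | exact Hy].
Qed.

Lemma Cmod_circle_pt (r t : R) : Cmod (circle_pt r t) = Rabs r.
Proof.
  unfold Cmod, circle_pt; simpl fst; simpl snd.
  replace ((r * cos t) ^ 2 + (r * sin t) ^ 2) with (Rsqr r).
  - apply sqrt_Rsqr_abs.
  - pose proof (sin2_cos2 t). unfold Rsqr in *. nra.
Qed.

Lemma continuous_circle (f : C -> C) (g : C -> R) (r t : R) :
  strictly_differentiable f -> Rabs r < 1 ->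
  (forall w w', Rabs (g w - g w') <= Cmod (w - w')%C) ->
  continuous (fun t => g (f (circle_pt r t))) t.
Proof.
  intros Hf Hr Hg.
  apply (continuity_2d_pt_snd (fun r t => g (f (circle_pt r t)))).
  apply (continuity_2d_circle (fun w => g (f w))). intros eps He.
  destruct (Hf (circle_pt r t)) as [d Hd]; [rewrite Cmod_circle_pt; assumption |].
  destruct (strict_deriv_cont _ _ _ eps Hd He) as [dl [Hdl K]].
  exists dl. split; [assumption |]. intros w Hw.
  eapply Rle_lt_trans; [apply Hg | apply K, Hw].
Qed.

Lemma fst_lipschitz (w w' : C) : Rabs (fst w - fst w') <= Cmod (w - w')%C.
Proof. apply (Rabs_fst_le_Cmod (w - w')%C). Qed.

(** The integral is constant in the radius. Its radial derivative is the integral of the radial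
    derivative of Re f, which by Cauchy-Riemann in polar form is 1/x times the angular derivative of
    Im f, and that integrates to 0 over a full turn. *)
Lemma mean_value_re (f : C -> C) (r : R) :
  strictly_differentiable f -> 0 <= r < 1 ->
  RInt (fun t => fst (f (circle_pt r t))) 0 (2 * PI) = 2 * PI * fst (f (RtoC 0)).
Proof.
  intros Hf Hr.
  (* The implication is placed under the existential so that choice yields a total derivative
     function, unconstrained off the disc. *)
  assert (Hd : forall z : C, exists d : C, Cmod z < 1 -> strict_deriv f z d).
  { intros z. destruct (Rlt_dec (Cmod z) 1) as [Hz | Hz].
    - destruct (Hf z Hz) as [d Hd]. exists d. auto.
    - exists (RtoC 0). intros; contradiction. }
  apply functional_choice in Hd. destruct Hd as [d Hd].
  set (D := fun x t => fst (d (circle_pt x t)) * cos t - snd (d (circle_pt x t)) * sin t).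
  assert (Hin : forall x t, Rabs x < 1 -> Cmod (circle_pt x t) < 1)
    by (intros; rewrite Cmod_circle_pt; assumption).
  assert (Dr : forall x t, Rabs x < 1 ->
    is_derive (fun x => fst (f (circle_pt x t))) x (D x t)).
  { intros x t Hx. pose proof (Hd _ (Hin x t Hx)) as S1. unfold D.
    destruct (d (circle_pt x t)) as [p q].
    apply strict_deriv_differentiable in S1. destruct S1 as [S1 _].
    apply is_derive_Reals. simpl.
    replace (p * cos t - q * sin t) with (p * cos t + - q * sin t) by ring.
    apply (derivable_pt_lim_comp_2d (fun u v => fst (f (u, v))) (fun x => x * cos t)
      (fun x => x * sin t)); [exact S1 | |];
      apply is_derive_Reals; auto_derive; auto; ring. }
  assert (Dt : forall x t, Rabs x < 1 ->
    is_derive (fun t => snd (f (circle_pt x t))) t (x * D x t)).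
  { intros x t Hx. pose proof (Hd _ (Hin x t Hx)) as S1. unfold D.
    destruct (d (circle_pt x t)) as [p q].
    apply strict_deriv_differentiable in S1. destruct S1 as [_ S1].
    apply is_derive_Reals. simpl.
    replace (x * (p * cos t - q * sin t)) with (q * (- (x * sin t)) + p * (x * cos t)) by ring.
    apply (derivable_pt_lim_comp_2d (fun u v => snd (f (u, v))) (fun t => x * cos t)
      (fun t => x * sin t)); [exact S1 | |];
      apply is_derive_Reals; auto_derive; auto; ring. }
  assert (Dc : forall x t, Rabs x < 1 -> continuity_2d_pt D x t).
  { intros x t Hx.
    assert (K : forall eps, 0 < eps -> exists dl, 0 < dl /\ forall w,
       Cmod (w - circle_pt x t)%C < dl -> Cmod (d w - d (circle_pt x t))%C < eps).
    { intros eps He.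
      destruct (strict_deriv_deriv_cont f d (circle_pt x t) (eps / 2)) as [dl [Hdl K]].
      - exists (1 - Rabs x). split; [lra |]. intros w Hw. apply Hd.
        replace w with ((w - circle_pt x t) + circle_pt x t)%C by ring.
        eapply Rle_lt_trans; [apply Cmod_triangle |]. rewrite Cmod_circle_pt. lra.
      - lra.
      - exists dl. split; [assumption |]. intros w Hw. specialize (K w Hw). lra. }
    apply continuity_2d_pt_minus; apply continuity_2d_pt_mult.
    - apply (continuity_2d_circle (fun w => fst (d w))). intros eps He.
      destruct (K eps He) as [dl [Hdl G]]. exists dl. split; [assumption |].
      intros w Hw. eapply Rle_lt_trans; [apply fst_lipschitz | auto].
    - apply continuity_1d_2d_pt_comp; [apply continuity_cos | apply continuity_2d_pt_id2].
    - apply (continuity_2d_circle (fun w => snd (d w))). intros eps He.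
      destruct (K eps He) as [dl [Hdl G]]. exists dl. split; [assumption |].
      intros w Hw. eapply Rle_lt_trans; [| apply (G w Hw)].
      apply (Rabs_snd_le_Cmod (d w - d (circle_pt x t))%C).
    - apply continuity_1d_2d_pt_comp; [apply continuity_sin | apply continuity_2d_pt_id2]. }
  assert (Loc : forall x, Rabs x < 1 -> locally x (fun y => Rabs y < 1)).
  { intros x Hx. exists (mkposreal (1 - Rabs x) ltac:(lra)). intros y Hy.
    change (Rabs (y - x) < 1 - Rabs x) in Hy.
    replace y with ((y - x) + x) by ring.
    eapply Rle_lt_trans; [apply Rabs_triang |]. lra. }
  set (M := fun x => RInt (fun t => fst (f (circle_pt x t))) 0 (2 * PI)).
  assert (DM : forall x, Rabs x < 1 -> is_derive M x (RInt (fun t => D x t) 0 (2 * PI))).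
  { intros x Hx.
    rewrite (RInt_ext (fun t => D x t)
      (fun t => Derive (fun u => fst (f (circle_pt u t))) x)).
    2: { intros t _. symmetry. apply is_derive_unique, Dr, Hx. }
    apply (is_derive_RInt_param (fun x t => fst (f (circle_pt x t)))).
    - generalize (Loc x Hx). apply filter_imp. intros y Hy t _. exists (D y t). apply Dr, Hy.
    - intros t _. apply continuity_2d_pt_ext_loc with D; [| apply Dc, Hx].
      destruct (Loc x Hx) as [dl Hdl]. exists dl. intros u v Hu _.
      symmetry. apply is_derive_unique, Dr, Hdl, Hu.
    - generalize (Loc x Hx). apply filter_imp. intros y Hy.
      apply (ex_RInt_continuous (V := R_CompleteNormedModule)). intros t _.
      apply (continuous_circle f fst); [assumption .. | apply fst_lipschitz]. }
  assert (Z : forall x, 0 < x < 1 -> RInt (fun t => D x t) 0 (2 * PI) = 0).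
  { intros x Hx. assert (Hx' : Rabs x < 1) by (rewrite Rabs_pos_eq; lra).
    assert (I : is_RInt (fun t => x * D x t) 0 (2 * PI)
       (minus (snd (f (circle_pt x (2 * PI)))) (snd (f (circle_pt x 0))))).
    { apply (is_RInt_derive (fun t => snd (f (circle_pt x t)))).
      - intros t _. apply Dt, Hx'.
      - intros t _. apply (continuous_scal_r x (D x)).
        apply (continuity_2d_pt_snd D), Dc, Hx'. }
    replace (circle_pt x (2 * PI)) with (circle_pt x 0) in I
      by (unfold circle_pt; rewrite cos_2PI, sin_2PI, cos_0, sin_0; reflexivity).
    rewrite minus_eq_zero in I.
    apply (is_RInt_scal _ _ _ (/ x)), (is_RInt_unique (V := R_CompleteNormedModule)) in I.
    transitivity (/ x * 0); [| apply Rmult_0_r].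
    refine (eq_trans _ I). apply RInt_ext. intros t _.
    unfold scal; simpl; unfold mult; simpl. field. lra. }
  (* The vanishing of the derivative required division by x, hence x > 0. This is enough: the mean
     value theorem asks only for continuity at the endpoint 0. *)
  destruct (MVT_gen M 0 r (fun _ => 0)) as [c [_ E]].
  - rewrite Rmin_left, Rmax_right by lra. intros x Hx.
    rewrite <- (Z x) by lra. apply DM. rewrite Rabs_pos_eq; lra.
  - rewrite Rmin_left, Rmax_right by lra. intros x Hx.
    apply continuity_pt_filterlim, (ex_derive_continuous M).
    eexists. apply DM. rewrite Rabs_pos_eq; lra.
  - assert (E' : M r = M 0) by lra. unfold M in E' at 1. rewrite E'. unfold M.
    rewrite (RInt_ext _ (fun _ => fst (f (RtoC 0)))).
    + rewrite RInt_const. unfold scal; simpl; unfold mult; simpl. ring.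
    + intros t _. unfold circle_pt. rewrite !Rmult_0_l. reflexivity.
Qed.

(** * Products of rotations and Jensen's inequality *)

Lemma strictly_differentiable_mult (f g : C -> C) :
  strictly_differentiable f -> strictly_differentiable g ->
  strictly_differentiable (fun z => f z * g z)%C.
Proof.
  intros Hf Hg z Hz. destruct (Hf z Hz) as [d Hd]. destruct (Hg z Hz) as [e He].
  eexists. apply strict_deriv_mult; eassumption.
Qed.

(** [circle_pt 1 (INR m * e)] is the unimodular number exp(i m e), so for z on a circle about 0 the
    factors sample f at n equally spaced angles. The step [e] is kept independent of [n] to allow
    induction over partial products. *)
Fixpoint rot_prod (f : C -> C) (e : R) (n : nat) (z : C) : C :=
  match n with
  | O => RtoC 1
  | S m => (rot_prod f e m z * f (circle_pt 1 (INR m * e) * z))%C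
  end.

Lemma strictly_differentiable_rot_prod (f : C -> C) (e : R) (n : nat) :
  strictly_differentiable f -> strictly_differentiable (rot_prod f e n).
Proof.
  intros Hf. induction n as [| n IH]; simpl.
  - intros z _. exists (RtoC 0). apply strict_deriv_const.
  - apply strictly_differentiable_mult; [exact IH |].
    assert (E : Cmod (circle_pt 1 (INR n * e)) = 1) by (rewrite Cmod_circle_pt; apply Rabs_R1).
    intros z Hz. destruct (Hf (circle_pt 1 (INR n * e) * z)%C) as [d Hd].
    + rewrite Cmod_mult, E, Rmult_1_l. exact Hz.
    + eexists. apply strict_deriv_rot; eassumption.
Qed.

Lemma rot_prod_0 (f : C -> C) (e : R) (n : nat) :
  f (RtoC 0) = RtoC 1 -> rot_prod f e n (RtoC 0) = RtoC 1.
Proof.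
  intros H. induction n as [| n IH]; simpl; [reflexivity |].
  rewrite IH, Cmult_0_r, H. ring.
Qed.

Lemma circle_pt_rot (r s t : R) : (circle_pt 1 s * circle_pt r t)%C = circle_pt r (t + s).
Proof.
  unfold circle_pt. rewrite cos_plus, sin_plus.
  apply injective_projections; simpl; ring.
Qed.

(** If |f| < 1 on the whole circle, then Re f < 1 there, and its mean could not be Re f(0) = 1. *)
Lemma exists_large_on_circle (f : C -> C) (r : R) :
  strictly_differentiable f -> 0 <= r < 1 -> f (RtoC 0) = RtoC 1 ->
  exists t : R, 0 <= t <= 2 * PI /\ 1 <= Cmod (f (circle_pt r t)).
Proof.
  intros Hf Hr H0.
  pose proof PI_RGT_0 as Hpi.
  destruct (classic
    (exists t : R, 0 <= t <= 2 * PI /\ 1 <= Cmod (f (circle_pt r t)))) as [H | H]; [exact H |].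
  exfalso.
  assert (L : RInt (fun t => fst (f (circle_pt r t))) 0 (2 * PI) < RInt (fun _ => 1) 0 (2 * PI)).
  { apply RInt_lt; [lra | intros; apply continuous_const | |].
    - intros t _. apply (continuous_circle f fst); [exact Hf | | apply fst_lipschitz].
      rewrite Rabs_pos_eq; lra.
    - intros t Ht. apply Rnot_le_lt. intros Hle. apply H. exists t.
      split; [lra |]. eapply Rle_trans; [exact Hle |].
      eapply Rle_trans; [apply Rle_abs | apply Rabs_fst_le_Cmod]. }
  rewrite mean_value_re, RInt_const, H0 in L by assumption.
  unfold scal in L; simpl in L; unfold mult in L; simpl in L. lra.
Qed.

Lemma ex_RInt_of_continuous (h : R -> R) (a b : R) :
  (forall t, continuous h t) -> ex_RInt h a b.
Proof. intros H. apply (ex_RInt_continuous (V := R_CompleteNormedModule)). auto. Qed.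

Lemma RInt_periodic (h : R -> R) (p t : R) :
  (forall x, continuous h x) -> (forall x, h (x + p) = h x) ->
  RInt h t (t + p) = RInt h 0 p.
Proof.
  intros Hc Hp.
  assert (E := ex_RInt_of_continuous h).
  assert (C1 := RInt_Chasles h t 0 p (E _ _ Hc) (E _ _ Hc)).
  assert (C2 := RInt_Chasles h t p (t + p) (E _ _ Hc) (E _ _ Hc)).
  assert (C3 := RInt_Chasles h 0 t 0 (E _ _ Hc) (E _ _ Hc)).
  rewrite RInt_point in C3.
  assert (S1 := RInt_comp_lin h 1 p 0 t (E _ _ Hc)).
  rewrite (RInt_ext _ h) in S1.
  2: { intros x _. unfold scal; simpl; unfold mult; simpl. rewrite !Rmult_1_l. apply Hp. }
  replace (1 * 0 + p) with p in S1 by ring. replace (1 * t + p) with (t + p) in S1 by ring.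
  unfold plus, zero in *; simpl in *. lra.
Qed.

(* Jensen's inequality [0 <= mean of ln|f|], tested against a continuous majorant
   of [ln|f|] so that zeros of [f] cause no trouble.  The mean value property of
   the product of the rotations of [f] by the N-th roots of unity gives an angle
   at which that product has modulus at least 1, and the logarithm of the product
   is N times a Riemann sum of [ln|f|]. *)
Lemma jensen_majorant (f : C -> C) (h : R -> R) (r : R) :
  strictly_differentiable f -> 0 <= r < 1 -> f (RtoC 0) = RtoC 1 ->
  (forall t, continuous h t) -> (forall t, h (t + 2 * PI) = h t) ->
  (forall t, 0 < Cmod (f (circle_pt r t)) -> ln (Cmod (f (circle_pt r t))) <= h t) ->
  0 <= RInt h 0 (2 * PI).
Proof.
  intros Hf Hr H0 Hc Hp Hh.
  pose proof PI_RGT_0 as Hpi.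
  apply Rnot_lt_le. intros Hneg.
  (* With this value the error 2 PI eps of the Riemann sum is half of the supposed deficit. *)
  set (eps := - RInt h 0 (2 * PI) / (4 * PI)).
  assert (He : 0 < eps) by (apply Rdiv_lt_0_compat; lra).
  (* The sampling starts at an unknown angle in [0, 2 PI] and covers one full turn, so it stays
     within [0, 4 PI]. *)
  destruct (Heine h (fun x => 0 <= x <= 4 * PI) (compact_P3 _ _)
    (fun x _ => proj2 (continuity_pt_filterlim h x) (Hc x)) (mkposreal eps He)) as [dl Hdl].
  simpl in Hdl.
  destruct (archimed_cor1 (dl / (2 * PI))) as [N [HN HN0]].
  { apply Rdiv_lt_0_compat; [apply cond_pos | lra]. }
  assert (HN' : 0 < INR N) by (apply lt_0_INR; exact HN0).
  set (e := 2 * PI / INR N).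
  assert (He0 : 0 < e) by (apply Rdiv_lt_0_compat; lra).
  assert (HNe : INR N * e = 2 * PI) by (unfold e; field; lra).
  assert (Hed : e < dl).
  { apply (Rmult_lt_compat_r (2 * PI)) in HN; [| lra].
    unfold e, Rdiv in *. field_simplify in HN; [| lra | lra].
    rewrite Rmult_comm. field_simplify; [| lra]. lra. }
  destruct (exists_large_on_circle (rot_prod f e N) r
    (strictly_differentiable_rot_prod f e N Hf) Hr (rot_prod_0 f e N H0)) as [t [Ht Hlarge]].
  (* Positivity of a partial product passes to all its factors, so each logarithm in the sum is
     genuine; at n = N it follows from the modulus being at least 1. *)
  assert (Main : forall n, (n <= N)%nat -> 0 < Cmod (rot_prod f e n (circle_pt r t)) ->
     e * ln (Cmod (rot_prod f e n (circle_pt r t))) - INR n * e * eps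
       <= RInt h t (t + INR n * e)).
  { induction n as [| n IH]; intros Hn Hpos.
    - simpl. rewrite Cmod_1, ln_1, !Rmult_0_l, Rplus_0_r, RInt_point.
      unfold zero; simpl. lra.
    - simpl rot_prod in *. rewrite circle_pt_rot, Cmod_mult in *.
      set (P := Cmod (rot_prod f e n (circle_pt r t))) in *.
      set (s := t + INR n * e) in *.
      set (Q := Cmod (f (circle_pt r s))) in *.
      assert (P0 : 0 <= P) by apply Cmod_ge_0. assert (Q0 : 0 <= Q) by apply Cmod_ge_0.
      assert (P1 : 0 < P) by nra. assert (Q1 : 0 < Q) by nra.
      specialize (IH ltac:(lia) P1).
      assert (Hs : h s >= ln Q) by (apply Rle_ge, Hh, Q1).
      rewrite ln_mult by assumption. rewrite S_INR.
      replace (t + (INR n + 1) * e) with (s + e) by (unfold s; ring).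
      rewrite <- (RInt_Chasles h t s (s + e)) by (apply ex_RInt_of_continuous, Hc).
      assert (B1 : 0 <= INR n * e) by (apply Rmult_le_pos; [apply pos_INR | lra]).
      assert (B2 : INR n * e + e <= 2 * PI).
      { rewrite <- HNe. replace (INR n * e + e) with (INR (S n) * e) by (rewrite S_INR; ring).
        apply Rmult_le_compat_r; [lra | apply le_INR, Hn]. }
      assert (St : RInt (fun _ => h s - eps) s (s + e) <= RInt h s (s + e)).
      { apply RInt_le; [lra | apply ex_RInt_const | apply ex_RInt_of_continuous, Hc |].
        intros x Hx.
        assert (K : Rabs (h x - h s) < eps).
        { apply Hdl; unfold s in *; try lra. rewrite Rabs_pos_eq; lra. }
        apply Rabs_def2 in K. lra. }
      rewrite RInt_const in St. unfold scal, plus in *; simpl in *; unfold mult in *; simpl in *.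
      nra. }
  specialize (Main N (le_n _) ltac:(lra)).
  rewrite HNe, RInt_periodic in Main by assumption.
  assert (0 <= ln (Cmod (rot_prod f e N (circle_pt r t)))) by (rewrite <- ln_1; apply ln_le; lra).
  assert (2 * PI * eps = - RInt h 0 (2 * PI) / 2) by (unfold eps; field; lra).
  nra.
Qed.

(** * The estimate on circles and for the operator norm *)

Lemma Cmod_sub_lipschitz (c w w' : C) :
  Rabs (Cmod (w - c)%C - Cmod (w' - c)%C) <= Cmod (w - w')%C.
Proof.
  assert (K : forall u v : C, Cmod (u - c)%C <= Cmod (u - v)%C + Cmod (v - c)%C).
  { intros u v. replace (u - c)%C with ((u - v) + (v - c))%C by ring. apply Cmod_triangle. }
  pose proof (K w w') as K1. pose proof (K w' w) as K2.
  replace (w' - w)%C with (- (w - w'))%C in K2 by ring. rewrite Cmod_opp in K2.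
  apply Rabs_le. lra.
Qed.

Lemma Cmod_lipschitz (w w' : C) : Rabs (Cmod w - Cmod w') <= Cmod (w - w')%C.
Proof.
  pose proof (Cmod_sub_lipschitz 0 w w') as H.
  replace (w - 0)%C with w in H by ring. replace (w' - 0)%C with w' in H by ring. exact H.
Qed.

Lemma mean_sub_one_le (g : C -> C) (r : R) :
  strictly_differentiable g -> 0 <= r < 1 -> g (RtoC 0) = RtoC 1 ->
  RInt (fun t => Cmod (g (circle_pt r t) - 1)%C) 0 (2 * PI)
    <= 195 / 100 * RInt (fun t => Cmod (g (circle_pt r t))) 0 (2 * PI).
Proof.
  intros Hg Hr H0.
  assert (Hr' : Rabs r < 1) by (rewrite Rabs_pos_eq; lra).
  set (u1 := fun t => Cmod (g (circle_pt r t))).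
  set (u2 := fun t => fst (g (circle_pt r t))).
  set (u3 := fun t => Cmod (g (circle_pt r t) - 1)%C).
  assert (C1 : forall t, continuous u1 t).
  { intros t. apply (continuous_circle g Cmod); auto using Cmod_lipschitz. }
  assert (C2 : forall t, continuous u2 t).
  { intros t. apply (continuous_circle g fst); auto using fst_lipschitz. }
  assert (C3 : forall t, continuous u3 t).
  { intros t. apply (continuous_circle g (fun w => Cmod (w - 1)%C)); auto using Cmod_sub_lipschitz. }
  (* This is the pointwise inequality solved for the logarithm and multiplied by 20: a continuous
     majorant of ln |g| even where g vanishes. *)
  set (h := fun t => minus (plus (scal 39 (u1 t)) (scal 18 (minus 1 (u2 t)))) (scal 20 (u3 t))).
  assert (J : 0 <= RInt h 0 (2 * PI)).
  { apply (jensen_majorant g h r); auto.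
    - intros t. apply (continuous_minus (V := R_NormedModule)); [apply (continuous_plus (V := R_NormedModule)) |].
      + apply (continuous_scal_r (V := R_NormedModule)), C1.
      + apply (continuous_scal_r (V := R_NormedModule)), (continuous_minus (V := R_NormedModule)).
        * apply continuous_const.
        * apply C2.
      + apply (continuous_scal_r (V := R_NormedModule)), C3.
    - intros t. unfold h, u1, u2, u3.
      replace (circle_pt r (t + 2 * PI)) with (circle_pt r t); [reflexivity |].
      unfold circle_pt. rewrite cos_plus, sin_plus, cos_2PI, sin_2PI. f_equal; ring.
    - intros t Ht. pose proof (Cmod_sub_one_le_log _ Ht) as K. unfold Re in K.
      unfold h, u1, u2, u3, minus, plus, opp, scal; simpl. unfold mult; simpl. lra. }
  assert (I1 := RInt_correct _ _ _ (ex_RInt_of_continuous u1 0 (2 * PI) C1)).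
  assert (I2 := RInt_correct _ _ _ (ex_RInt_of_continuous u2 0 (2 * PI) C2)).
  assert (I3 := RInt_correct _ _ _ (ex_RInt_of_continuous u3 0 (2 * PI) C3)).
  assert (I := is_RInt_minus _ _ _ _ _ _ (is_RInt_plus _ _ _ _ _ _ (is_RInt_scal _ _ _ 39 _ I1)
     (is_RInt_scal _ _ _ 18 _ (is_RInt_minus _ _ _ _ _ _ (is_RInt_const 0 (2 * PI) 1) I2)))
     (is_RInt_scal _ _ _ 20 _ I3)).
  apply (is_RInt_unique (V := R_CompleteNormedModule)) in I.
  change (RInt h 0 (2 * PI) = minus (plus (scal 39 (RInt u1 0 (2 * PI)))
    (scal 18 (minus (scal (2 * PI - 0) 1) (RInt u2 0 (2 * PI))))) (scal 20 (RInt u3 0 (2 * PI)))) in I.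
  assert (M : RInt u2 0 (2 * PI) = 2 * PI)
    by (unfold u2; rewrite mean_value_re, H0 by assumption; simpl; ring).
  rewrite I, M in J.
  unfold minus, plus, opp, scal in J; simpl in J; unfold mult in J; simpl in J. lra.
Qed.

Lemma analytic_strictly_differentiable (f : C -> C) :
  analytic_on unit_disc f -> strictly_differentiable f.
Proof. intros Hf z Hz. exact (analytic_strict_deriv f z Hf Hz). Qed.

Lemma circle_mean_opB_le (f : C -> C) (r : R) :
  analytic_on unit_disc f -> 0 <= r < 1 ->
  circle_mean (opB f) r <= 195 / 100 * circle_mean f r.
Proof.
  intros Ha Hr. pose proof PI_RGT_0 as Hpi.
  assert (Hf := analytic_strictly_differentiable f Ha).
  assert (Hr' : Rabs r < 1) by (rewrite Rabs_pos_eq; lra).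
  assert (Cf0 : forall t, continuous (fun t => Cmod (f (circle_pt r t))) t).
  { intros t. apply (continuous_circle f Cmod); auto using Cmod_lipschitz. }
  unfold circle_mean.
  assert (Goal0 : RInt (fun t => Cmod (opB f (circle_pt r t))) 0 (2 * PI)
     <= 195 / 100 * RInt (fun t => Cmod (f (circle_pt r t))) 0 (2 * PI)).
  2: { assert (0 < / (2 * PI)) by (apply Rinv_0_lt_compat; lra). nra. }
  unfold opB. set (c := f (RtoC 0)).
  destruct (Ceq_dec c 0) as [Hc | Hc].
  (* Normalisation is impossible when f(0) = 0, but then [opB f] agrees with f and 1 <= 1.95
     suffices. *)
  - rewrite Hc.
    rewrite (RInt_ext _ (fun t => Cmod (f (circle_pt r t)))).
    2: { intros t _. f_equal. ring. }
    assert (0 <= RInt (fun t => Cmod (f (circle_pt r t))) 0 (2 * PI)).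
    { apply RInt_ge_0; [lra | apply ex_RInt_of_continuous, Cf0 | intros; apply Cmod_ge_0]. }
    lra.
  - assert (Hm : 0 < Cmod c) by (apply Cmod_gt_0, Hc).
    set (g := fun z => (/ c * f z)%C).
    assert (Hg : strictly_differentiable g).
    { apply (strictly_differentiable_mult (fun _ => / c)%C f); [| exact Hf].
      intros z _. exists (RtoC 0). apply strict_deriv_const. }
    assert (Dg : forall t, continuous (fun t => Cmod (g (circle_pt r t))) t).
    { intros t. apply (continuous_circle g Cmod); auto using Cmod_lipschitz. }
    assert (Dg1 : forall t, continuous (fun t => Cmod (g (circle_pt r t) - 1)%C) t).
    { intros t. apply (continuous_circle g (fun w => Cmod (w - 1)%C)); auto using Cmod_sub_lipschitz. }
    assert (K := mean_sub_one_le g r Hg Hr (Cinv_l c Hc)).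
    rewrite (RInt_ext (fun t => Cmod (f (circle_pt r t) - c)%C)
      (fun t => scal (Cmod c) (Cmod (g (circle_pt r t) - 1)%C))).
    2: { intros t _. unfold scal; simpl; unfold mult; simpl. rewrite <- Cmod_mult.
         f_equal. unfold g. field. exact Hc. }
    rewrite (RInt_ext (fun t => Cmod (f (circle_pt r t)))
      (fun t => scal (Cmod c) (Cmod (g (circle_pt r t))))).
    2: { intros t _. unfold scal; simpl; unfold mult; simpl. rewrite <- Cmod_mult.
         f_equal. unfold g. field. exact Hc. }
    rewrite !(RInt_scal (V := R_CompleteNormedModule)) by (apply ex_RInt_of_continuous; assumption).
    unfold scal; simpl; unfold mult; simpl. nra.
Qed.

Lemma circle_mean_le_H1_norm (f : C -> C) (r : R) :
  0 <= r < 1 -> Rbar_le (circle_mean f r) (H1_norm f).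
Proof.
  intros Hr. apply (proj1 (Lub_Rbar_correct _)). exists r. auto.
Qed.

Lemma H1_norm_opB_le (f : C -> C) (m : R) :
  analytic_on unit_disc f -> Rbar_le (H1_norm f) m ->
  Rbar_le (H1_norm (opB f)) (195 / 100 * m).
Proof.
  intros Hf Hm. apply (proj2 (Lub_Rbar_correct _)). intros x [r [Hr ->]].
  assert (K := Rbar_le_trans _ _ _ (circle_mean_le_H1_norm f r Hr) Hm). simpl in *.
  eapply Rle_trans; [apply circle_mean_opB_le; assumption | lra].
Qed.

Theorem theorem2p3 :
  (forall f : C -> C, in_H1 f -> in_H1 (opB f)) /\
  Rbar_le (H1_operator_norm opB) (Finite 1.952396).
Proof.
  split.
  - intros f [Hf Hn]. split; [apply analytic_on_sub_const, Hf |].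
    assert (H : exists m : R, Rbar_le (H1_norm f) m).
    (* The value -oo cannot be a supremum of circle means; rather than excluding it, the bound 0 is
       given for that case. *)
    { destruct (H1_norm f) as [m | |]; [exists m; apply Rle_refl | destruct Hn | exists 0; exact I]. }
    destruct H as [m Hm].
    exact (Rbar_le_lt_trans _ _ p_infty (H1_norm_opB_le f m Hf Hm) I).
  - unfold H1_operator_norm, Rbar_lub.
    apply (proj2 (proj2_sig (Rbar_ex_lub _))).
    intros N [f [[Hf _] [Hm ->]]].
    eapply Rbar_le_trans; [apply (H1_norm_opB_le f 1 Hf Hm) |]. simpl. lra.
Qed.
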